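(* Let $G$ be a weighted simple graph on the nodes $1,\dots,n$ with symmetric weight matrix $W=(w_{ij})$, where $w_{ij}=0$ if the nodes $i$ and $j$ are not connected by an edge. Let $a_1,\dots,a_n$ be positive real numbers and let $r=(r_{ij})$ be a symmetric $n\times n$ matrix. Let $T_v^r$ be the operator given by $$(T_v^r\mathbf{y})_i=\sum_j(a_iy_i-a_jy_j)\,w_{ij}\,\frac{2r_{ij}}{a_i+a_j},$$ and let $D$ be the degree matrix, i.e. the diagonal matrix with entries $d_{ii}=\sum_j w_{ij}$ (with $d_{ii}>0$, so that $D^{-1/2}$ is defined). Then the operator $D^{-1/2}T_v^rD^{-1/2}$ is self-adjoint in $\ell^2_X$ and non-negative, where $X=\mathrm{diag}(ca_i)$ for some positive $c$. Furthermore, $D^{-1/2}T_v^rD^{-1/2}\mathbf{u}=0$ if and only if $(D^{-1/2}\mathbf{u})_i\,a_i$ is constant on connected components of the graph $G$.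
   Context: For a positive definite real $n\times n$ matrix $A$, $\langle \mathbf{y},\mathbf{z}\rangle_A:=\mathbf{y}^tA\mathbf{z}$ for $\mathbf{y},\mathbf{z}\in\mathbb{R}^n$; $\ell^2_X$ denotes $\mathbb{R}^n$ with the inner product $\langle\cdot,\cdot\rangle_X$. An operator $S$ is non-negative in $\ell^2_X$ if $\langle\mathbf{u},S\mathbf{u}\rangle_X\ge0$ for all $\mathbf{u}\in\mathbb{R}^n$.
   Formalization: Edge weights are taken positive, and since symmetry of r alone is not enough (one edge with r_12 = -1 or 0 is a counterexample), r_ij ≥ 0 on edges is assumed for non-negativity and r_ij > 0 on edges for the kernel claim; self-adjointness is for all symmetric r. *)

(* Defs.v *)
From HB Require Import structures.
From mathcomp Require Import all_boot all_order all_algebra.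
From mathcomp Require Import reals.

Set Implicit Arguments.
Unset Strict Implicit.
Unset Printing Implicit Defensive.

Import Order.TTheory GRing.Theory Num.Theory.
Local Open Scope ring_scope.

Definition inner (R : realType) (n : nat) (A : 'M[R]_n) (y z : 'cV[R]_n) : R :=
  (y^T *m A *m z) ord0 ord0.

Definition posdef (R : realType) (n : nat) (A : 'M[R]_n) : Prop :=
  A^T = A /\ forall y : 'cV[R]_n, y != 0 -> 0 < inner A y y.

Definition selfadjoint_in (R : realType) (n : nat) (X : 'M[R]_n)
    (S : 'cV[R]_n -> 'cV[R]_n) : Prop :=
  forall u v : 'cV[R]_n, inner X (S u) v = inner X u (S v).

Definition nonneg_in (R : realType) (n : nat) (X : 'M[R]_n)
    (S : 'cV[R]_n -> 'cV[R]_n) : Prop :=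
  forall u : 'cV[R]_n, 0 <= inner X u (S u).

(* An edge is required to carry a positive weight, so that the support of W
   is exactly the edge set. *)
Record weighted_simple_graph (R : realType) (n : nat)
    (e : rel 'I_n) (W : 'M[R]_n) : Prop := WeightedSimpleGraph {
  edge_sym : symmetric e;
  edge_irr : irreflexive e;
  weight_sym : W^T = W;
  weight_pos : forall i j, e i j -> 0 < W i j;
  weight_eq0 : forall i j, ~~ e i j -> W i j = 0
}.

Definition degree_mx (R : realType) (n : nat) (W : 'M[R]_n) : 'M[R]_n :=
  diag_mx (\row_i \sum_j W i j).

(* Only meaningful for a diagonal matrix with positive diagonal entries. *)
Definition diag_inv_sqrt (R : realType) (n : nat) (D : 'M[R]_n) : 'M[R]_n :=
  diag_mx (\row_i (Num.sqrt (D i i))^-1).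

Definition Tvr (R : realType) (n : nat) (W r : 'M[R]_n) (a : 'I_n -> R)
    (y : 'cV[R]_n) : 'cV[R]_n :=
  \col_i \sum_j (a i * y i ord0 - a j * y j ord0)
                * W i j * (2 * r i j / (a i + a j)).

Definition normalized_Tvr (R : realType) (n : nat) (W r : 'M[R]_n)
    (a : 'I_n -> R) (u : 'cV[R]_n) : 'cV[R]_n :=
  let Dm := diag_inv_sqrt (degree_mx W) in Dm *m Tvr W r a (Dm *m u).

(* Main.v *)
(* In the coordinates x_i = a_i (D^{-1/2} u)_i, z_i = a_i (D^{-1/2} v)_i, the form
   <u, D^{-1/2} T D^{-1/2} v>_X is c times the form of a graph Laplacian with
   symmetric weights k_ij = 2 w_ij r_ij / (a_i + a_j), namely
   c/2 * sum_ij k_ij (x_i - x_j) (z_i - z_j).  This is visibly symmetric, and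
   non-negative for x = z when k >= 0; it then vanishes iff x is constant along
   every edge with k_ij > 0. *)

Require Import Defs.
From HB Require Import structures.
From mathcomp Require Import all_boot all_order all_algebra.
From mathcomp Require Import reals ring.

Set Implicit Arguments.
Unset Strict Implicit.
Unset Printing Implicit Defensive.

Import Order.TTheory GRing.Theory Num.Theory.
Local Open Scope ring_scope.

Section GraphLaplacian.
Variables (R : realFieldType) (I : finType) (k : I -> I -> R).
Hypothesis k_sym : forall i j, k i j = k j i.

(** Summation by parts: exchanging [i] and [j] and using [k_sym] gives a second expression of the
    left side, with [z j * (x j - x i)] in place of [z i * (x i - x j)]. The right side is the
    average of the two. *)
Lemma laplacian_form (z x : I -> R) :
  \sum_i z i * \sum_j (x i - x j) * k i j =
  2^-1 * \sum_i \sum_j k i j * ((x i - x j) * (z i - z j)).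
Proof.
have E : \sum_i z i * \sum_j (x i - x j) * k i j =
         \sum_i \sum_j z i * ((x i - x j) * k i j).
  by apply: eq_bigr => i _; rewrite big_distrr.
have E' : \sum_i z i * \sum_j (x i - x j) * k i j =
          \sum_i \sum_j z j * ((x j - x i) * k i j).
  rewrite E exchange_big /=; apply: eq_bigr => i _; apply: eq_bigr => j _.
  by rewrite k_sym.
apply: (@mulfI _ 2); first by rewrite pnatr_eq0.
rewrite mulVKf ?pnatr_eq0// mulr2n mulrDl mul1r {1}E E' -big_split /=.
apply: eq_bigr => i _; rewrite -big_split /=; apply: eq_bigr => j _; ring.
Qed.

Lemma laplacian_form_ge0 (x : I -> R) : (forall i j, 0 <= k i j) ->
  0 <= \sum_i x i * \sum_j (x i - x j) * k i j.
Proof.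
move=> k_ge0; rewrite laplacian_form mulr_ge0 ?invr_ge0 ?ler0n//.
apply: sumr_ge0 => i _; apply: sumr_ge0 => j _.
by rewrite mulr_ge0// -expr2 sqr_ge0.
Qed.

(** By [laplacian_form] the form is half a sum of terms [k i j * (x i - x j)^2], all non-negative,
    so each of them vanishes with the sum. *)
Lemma laplacian_form_eq0 (x : I -> R) : (forall i j, 0 <= k i j) ->
  \sum_i x i * \sum_j (x i - x j) * k i j = 0 ->
  forall i j, 0 < k i j -> x i = x j.
Proof.
move=> k_ge0 /eqP; rewrite laplacian_form mulf_eq0 invr_eq0 pnatr_eq0 /=.
have t_ge0 i j : 0 <= k i j * ((x i - x j) * (x i - x j)).
  by rewrite mulr_ge0// -expr2 sqr_ge0.
move=> /eqP s0 i j kij_gt0.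
have row0 : \sum_j k i j * ((x i - x j) * (x i - x j)) = 0 :=
  psumr_eq0P (fun i _ => sumr_ge0 _ (fun j _ => t_ge0 i j)) s0 isT.
have /eqP : k i j * ((x i - x j) * (x i - x j)) = 0 :=
  psumr_eq0P (fun j _ => t_ge0 i j) row0 isT.
by rewrite mulf_eq0 gt_eqF//= mulf_eq0 orbb subr_eq0 => /eqP.
Qed.

End GraphLaplacian.

Lemma connect_eq (T : finType) (V : Type) (e : rel T) (f : T -> V) :
  (forall i j, e i j -> f i = f j) -> forall i j, connect e i j -> f i = f j.
Proof.
move=> fe i j /connectP[p]; elim: p i => [i _ -> //|k p IHp i /= /andP[eik ep] jl].
by rewrite (fe _ _ eik); apply: IHp.
Qed.

(** A 1 x 1 matrix equals its transpose. *)
Lemma inner_sym (R : realType) n (X : 'M[R]_n) (y z : 'cV[R]_n) :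
  X^T = X -> inner X y z = inner X z y.
Proof.
move=> X_sym; rewrite /inner -[in RHS](trmxK (_ *m y)) [RHS]mxE.
by rewrite !trmx_mul X_sym trmxK mulmxA.
Qed.

Lemma inner_diag (R : realType) n (d : 'rV[R]_n) (y z : 'cV[R]_n) :
  inner (diag_mx d) y z = \sum_i d ord0 i * (y i ord0 * z i ord0).
Proof.
rewrite /inner -mulmxA mul_diag_mx mxE; apply: eq_bigr => i _.
by rewrite !mxE mulrCA.
Qed.

Lemma posdef_diag (R : realType) n (d : 'rV[R]_n) :
  (forall i, 0 < d ord0 i) -> posdef (diag_mx d).
Proof.
move=> d_gt0; split=> [|y y_neq0]; first exact: tr_diag_mx.
have t_ge0 i : 0 <= d ord0 i * (y i ord0 * y i ord0).
  by rewrite mulr_ge0 ?(ltW (d_gt0 i))// -expr2 sqr_ge0.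
rewrite inner_diag lt_neqAle sumr_ge0// andbT eq_sym.
apply: contra y_neq0 => /eqP s0; apply/eqP/matrixP => i j; rewrite ord1 mxE.
have /eqP : d ord0 i * (y i ord0 * y i ord0) = 0 :=
  psumr_eq0P (fun i _ => t_ge0 i) s0 isT.
by rewrite mulf_eq0 gt_eqF//= mulf_eq0 orbb => /eqP.
Qed.

Section NormalizedOperator.
Variables (R : realType) (n : nat) (W r : 'M[R]_n) (a : 'I_n -> R).

Let s i : R := (Num.sqrt (degree_mx W i i))^-1.
Let k i j : R := W i j * (2 * r i j / (a i + a j)).
Let x (u : 'cV[R]_n) i : R :=
  a i * (diag_inv_sqrt (degree_mx W) *m u) i ord0.

Lemma normalized_TvrE u i :
  normalized_Tvr W r a u i ord0 = s i * \sum_j (x u i - x u j) * k i j.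
Proof.
rewrite /normalized_Tvr {1}/diag_inv_sqrt mul_diag_mx mxE mxE [Tvr _ _ _ _ _ _]mxE.
congr (_ * _).
by apply: eq_bigr => j _; rewrite -mulrA.
Qed.

(** This is where the choice of [X] matters: its factor [a i], the outer factor [s i] of the
    operator and the entry of [v] combine to [x v i], the same coordinate that occurs inside the
    operator for [u]. *)
Lemma inner_normalized_Tvr c u v :
  inner (diag_mx (\row_i (c * a i))) v (normalized_Tvr W r a u) =
  c * \sum_i x v i * \sum_j (x u i - x u j) * k i j.
Proof.
rewrite inner_diag big_distrr /=; apply: eq_bigr => i _.
have -> : x v i = a i * (s i * v i ord0).
  by rewrite /x /diag_inv_sqrt mul_diag_mx mxE mxE.
rewrite normalized_TvrE mxE; ring.
Qed.

End NormalizedOperator.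

Theorem corollary3p4 (R : realType) (n : nat) (e : rel 'I_n)
    (W r : 'M[R]_n) (a : 'I_n -> R)
    (hG : weighted_simple_graph e W)
    (ha : forall i, 0 < a i)
    (hr : r^T = r)
    (hD : forall i, 0 < degree_mx W i i) :
  (forall c : R, 0 < c ->
     let X := diag_mx (\row_i (c * a i)) in
     [/\ posdef X,
         selfadjoint_in X (normalized_Tvr W r a) &
         (forall i j, e i j -> 0 <= r i j) ->
           nonneg_in X (normalized_Tvr W r a)]) /\
  ((forall i j, e i j -> 0 < r i j) ->
     forall u : 'cV[R]_n,
       normalized_Tvr W r a u = 0 <->
       (forall i j, connect e i j ->
          (diag_inv_sqrt (degree_mx W) *m u) i ord0 * a i =
          (diag_inv_sqrt (degree_mx W) *m u) j ord0 * a j)).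
Proof.
case: hG => _ _ W_sym W_gt0 W_eq0.
set k := fun i j => W i j * (2 * r i j / (a i + a j)).
have k_sym i j : k i j = k j i.
  by rewrite /k -[in LHS]W_sym -[in LHS]hr !mxE [a i + _]addrC.
have k_ge0 : (forall i j, e i j -> 0 <= r i j) -> forall i j, 0 <= k i j.
  (* Off the edges the sign of [r i j] is unknown, but there the weight is zero and kills
     [k i j]. *)
  move=> r_ge0 i j; have [eij|/W_eq0 Wij0] := boolP (e i j).
    by rewrite mulr_ge0 ?(ltW (W_gt0 _ _ eij))// divr_ge0 ?mulr_ge0 ?r_ge0// ltW ?addr_gt0.
  by rewrite /k Wij0 mul0r.
split=> [c c_gt0 X|r_gt0 u].
  have X_sym : X^T = X by exact: tr_diag_mx.
  split=> [|u v|r_ge0 u].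
  - by apply: posdef_diag => i; rewrite mxE mulr_gt0.
  (* With the operator in the second slot on both sides, the two Laplacian forms differ only in the
     order of the factors [x i - x j] and [z i - z j]. *)
  - rewrite inner_sym// !inner_normalized_Tvr !(laplacian_form k_sym).
    by congr (_ * (_ * _)); do 2!(apply: eq_bigr => ? _); rewrite [X in _ * X]mulrC.
  - rewrite inner_normalized_Tvr mulr_ge0 ?(ltW c_gt0)//.
    exact: (laplacian_form_ge0 k_sym) (k_ge0 r_ge0).
have {}k_ge0 := k_ge0 (fun i j eij => ltW (r_gt0 i j eij)).
split=> [Nu0|x_const].
  (* It suffices to compare the ends of one edge, where [k i j] is positive because [W i j] and
     [r i j] are. *)
  apply: connect_eq => i j eij; rewrite ![_ * a _]mulrC.
  apply: (laplacian_form_eq0 k_sym (x := fun i => a i * _ i ord0)) => //.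
    (* The kernel does not depend on the scale of [X], so [c = 1] is taken. *)
    have := inner_normalized_Tvr W r a 1 u u.
    by rewrite Nu0 /inner mulmx0 mxE mul1r => <-.
  by rewrite mulr_gt0 ?W_gt0// divr_gt0 ?mulr_gt0 ?r_gt0 ?addr_gt0.
(* Conversely every summand vanishes: on an edge by the difference, elsewhere by the weight. *)
apply/matrixP => i j; rewrite ord1 normalized_TvrE [RHS]mxE big1 ?mulr0// => l _.
have [eil|/W_eq0 ->] := boolP (e i l); last by rewrite mul0r mulr0.
by rewrite ![a _ * _]mulrC (x_const _ _ (connect1 eil)) subrr mul0r.
Qed.
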